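(* Let $(\mathscr{E},\mathcal{S})$ be a Frobenius category, $\mathrm{inj}\,\mathscr{E}$ its full subcategory of $\mathcal{S}$-injective objects, and $\underline{\mathscr{E}}=\mathscr{E}/\mathrm{inj}\,\mathscr{E}$ its stable category with its standard triangulated structure. For a subcategory $\mathscr{D}$ of $\mathscr{E}$ containing $\mathrm{inj}\,\mathscr{E}$, let $F\mathscr{D}$ be the full subcategory of $\underline{\mathscr{E}}$ whose objects are the objects of $\mathscr{D}$; for a subcategory $\underline{\mathscr{D}}$ of $\underline{\mathscr{E}}$, let $G\underline{\mathscr{D}}$ be the full subcategory of $\mathscr{E}$ whose objects are the objects of $\underline{\mathscr{D}}$. (1) $F$ and $G$ give a one-to-one correspondence (mutually inverse bijections) between thick subcategories of $\mathscr{E}$ containing $\mathrm{inj}\,\mathscr{E}$ and thick triangulated subcategories of $\underline{\mathscr{E}}$. (2) $F$ and $G$ give a one-to-one correspondence (mutually inverse bijections) between complete subcategories of $\mathscr{E}$ containing $\mathrm{inj}\,\mathscr{E}$ and triangulated subcategories of $\underline{\mathscr{E}}$.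
   Context: $(\mathscr{E},\mathcal{S})$ is an exact category in the sense of Quillen; the elements of $\mathcal{S}$ are the short exact sequences $X\xrightarrow{f}Y\xrightarrow{g}Z$, with $f$ called an admissible monomorphism and $g$ an admissible epimorphism. An object $P$ is $\mathcal{S}$-projective if every morphism $P\to Z$ lifts along every admissible epimorphism $Y\to Z$; an object $I$ is $\mathcal{S}$-injective if every morphism $X\to I$ extends along every admissible monomorphism $X\to Y$. $\mathscr{E}$ is Frobenius if every object $X$ admits an admissible epimorphism $P\to X$ with $P$ $\mathcal{S}$-projective and an admissible monomorphism $X\to I$ with $I$ $\mathcal{S}$-injective, and the $\mathcal{S}$-projective and $\mathcal{S}$-injective objects coincide. Stable category: $\underline{\mathscr{E}}$ has the same objects as $\mathscr{E}$; its morphisms are those of $\mathscr{E}$ modulo the subgroups of morphisms factoring through an $\mathcal{S}$-injective object; $\underline f$ is the class of $f$. Triangulated structure: for each $X$ choose a sequence $X\xrightarrow{\mu}I\xrightarrow{\pi}TX$ in $\mathcal{S}$ with $I$ $\mathcal{S}$-injective; this defines an autoequivalence $T$ of $\underline{\mathscr{E}}$ (on $f:X\to Y$, $T(f)$ is the class of the map $TX\to TY$ induced by extending $f$ to the chosen injectives). For $f:X\to Y$, let $C_f$ be the pushout of $\mu$ and $f$, with maps $g:Y\to C_f$ and $\overline f:I\to C_f$, and let $h:C_f\to TX$ be the map with $hg=0$, $h\overline f=\pi$; the image in $\underline{\mathscr{E}}$ of $X\xrightarrow{f}Y\xrightarrow{g}C_f\xrightarrow{h}TX$ is a standard triangle.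 The distinguished triangles are the triangles isomorphic in $\underline{\mathscr{E}}$ to a standard triangle. A nonempty full subcategory $\mathscr{D}$ of $\mathscr{E}$ is complete if whenever $X\to Y\to Z$ is in $\mathcal{S}$ and two of $X,Y,Z$ are in $\mathscr{D}$, so is the third; it is thick if moreover it is closed under direct summands. A nonempty full subcategory of a triangulated category is a triangulated subcategory if for every distinguished triangle $X\to Y\to Z\to TX$ with two of $X,Y,Z$ in it, the third is also in it; it is a thick triangulated subcategory if moreover it is closed under direct summands. Here $A$ is a direct summand of $X$ if there are morphisms $A\xrightarrow{i}X\xrightarrow{p}A$ with $pi=1_A$. A subcategory contains $\mathrm{inj}\,\mathscr{E}$ if all $\mathcal{S}$-injective objects are objects of it. *)

(* Defs.v *)
From HB Require Import structures.
From mathcomp Require Import all_boot all_algebra.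
From mathcomp Require Import boolp.

Set Implicit Arguments.
Unset Strict Implicit.
Unset Printing Implicit Defensive.

Import GRing.Theory.
Local Open Scope ring_scope.
Local Open Scope quotient_scope.

(** * Additive categories *)

(* Hom-groups are [zmodType]s, whose choice structure costs no generality
   classically. Equality of morphisms is Leibniz equality. *)
Record PreAddCat := MkPreAddCat {
  obj :> Type;
  hom : obj -> obj -> zmodType;
  idm : forall X, hom X X;
  comp : forall X Y Z, hom Y Z -> hom X Y -> hom X Z;
  compA : forall W X Y Z (h : hom Y Z) (g : hom X Y) (f : hom W X),
    comp h (comp g f) = comp (comp h g) f;
  comp1m : forall X Y (f : hom X Y), comp (idm Y) f = f;
  compm1 : forall X Y (f : hom X Y), comp f (idm X) = f;
  compDl : forall X Y Z (g g' : hom Y Z) (f : hom X Y),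
    comp (g + g') f = comp g f + comp g' f;
  compDr : forall X Y Z (g : hom Y Z) (f f' : hom X Y),
    comp g (f + f') = comp g f + comp g f'
}.

Arguments hom {p} X Y.
Arguments idm {p} X.
Arguments comp {p X Y Z} g f.

Notation "g '\oc' f" := (comp g f) (at level 40, left associativity).

Section Universal.
Variable C : PreAddCat.
Implicit Types W X Y Z : C.

Definition is_zero Z : Prop :=
  (forall X (f : hom X Z), f = 0) /\ (forall X (f : hom Z X), f = 0).

Definition is_biproduct X Y B (i1 : hom X B) (i2 : hom Y B)
    (p1 : hom B X) (p2 : hom B Y) : Prop :=
  [/\ p1 \oc i1 = idm X, p2 \oc i2 = idm Y, p1 \oc i2 = 0, p2 \oc i1 = 0
    & i1 \oc p1 + i2 \oc p2 = idm B].

Definition is_iso X Y (f : hom X Y) : Prop :=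
  exists g : hom Y X, g \oc f = idm X /\ f \oc g = idm Y.

Definition is_kernel X Y Z (f : hom X Y) (g : hom Y Z) : Prop :=
  g \oc f = 0 /\
  forall W (t : hom W Y), g \oc t = 0 -> exists! s : hom W X, f \oc s = t.

Definition is_cokernel X Y Z (f : hom X Y) (g : hom Y Z) : Prop :=
  g \oc f = 0 /\
  forall W (t : hom Y W), t \oc f = 0 -> exists! s : hom Z W, s \oc g = t.

(*  X --f--> Y
    |a       |b
    X' -f'-> Y'  *)
Definition is_pushout X Y X' Y' (f : hom X Y) (a : hom X X')
    (b : hom Y Y') (f' : hom X' Y') : Prop :=
  b \oc f = f' \oc a /\
  forall W (s : hom Y W) (t : hom X' W), s \oc f = t \oc a ->
    exists! r : hom Y' W, r \oc b = s /\ r \oc f' = t.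

Definition is_pullback X Y X' Y' (f : hom X Y) (a : hom X X')
    (b : hom Y Y') (f' : hom X' Y') : Prop :=
  b \oc f = f' \oc a /\
  forall W (s : hom W Y) (t : hom W X'), b \oc s = f' \oc t ->
    exists! r : hom W X, f \oc r = s /\ a \oc r = t.

Definition is_summand A X : Prop :=
  exists (i : hom A X) (p : hom X A), p \oc i = idm A.

End Universal.

Record AddCat := MkAddCat {
  preadd :> PreAddCat;
  has_zero : exists Z : preadd, is_zero Z;
  has_biproducts : forall X Y : preadd,
    exists (B : preadd) (i1 : hom X B) (i2 : hom Y B)
           (p1 : hom B X) (p2 : hom B Y), is_biproduct i1 i2 p1 p2
}.

(* A full subcategory is given by its class of objects. *)
Definition FullSubcat (C : PreAddCat) := C -> Prop.

Definition nonempty (C : PreAddCat) (D : FullSubcat C) : Prop :=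
  exists X, D X.

Definition two_of_three (C : PreAddCat) (D : FullSubcat C) (X Y Z : C) : Prop :=
  [/\ D X -> D Y -> D Z, D X -> D Z -> D Y & D Y -> D Z -> D X].

Definition summand_closed (C : PreAddCat) (D : FullSubcat C) : Prop :=
  forall A X : C, is_summand A X -> D X -> D A.

(** * Exact and Frobenius categories *)

Definition SeqClass (C : PreAddCat) :=
  forall X Y Z : C, hom X Y -> hom Y Z -> Prop.

Section SeqClassTheory.
Variables (C : PreAddCat) (S : SeqClass C).

Definition adm_mono (X Y : C) (f : hom X Y) : Prop :=
  exists (Z : C) (g : hom Y Z), S f g.

Definition adm_epi (Y Z : C) (g : hom Y Z) : Prop :=
  exists (X : C) (f : hom X Y), S f g.

(* Quillen's axioms, in their original form; the two "obscure" axioms are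
   included although they follow from the others. *)
Record exact_axioms : Prop := MkExactAxioms {
  ex_iso : forall (X Y Z X' Y' Z' : C) (f : hom X Y) (g : hom Y Z)
      (f' : hom X' Y') (g' : hom Y' Z')
      (a : hom X X') (b : hom Y Y') (c : hom Z Z'),
    is_iso a -> is_iso b -> is_iso c ->
    b \oc f = f' \oc a -> c \oc g = g' \oc b -> S f g -> S f' g';
  ex_split : forall (X Y B : C) (i1 : hom X B) (i2 : hom Y B)
      (p1 : hom B X) (p2 : hom B Y), is_biproduct i1 i2 p1 p2 -> S i1 p2;
  ex_kernel : forall (X Y Z : C) (f : hom X Y) (g : hom Y Z),
    S f g -> is_kernel f g;
  ex_cokernel : forall (X Y Z : C) (f : hom X Y) (g : hom Y Z),
    S f g -> is_cokernel f g;
  ex_epi_comp : forall (X Y Z : C) (f : hom X Y) (g : hom Y Z),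
    adm_epi f -> adm_epi g -> adm_epi (g \oc f);
  ex_mono_comp : forall (X Y Z : C) (f : hom X Y) (g : hom Y Z),
    adm_mono f -> adm_mono g -> adm_mono (g \oc f);
  ex_pullback : forall (Y X' Y' : C) (b : hom Y Y') (f' : hom X' Y'),
    adm_epi f' ->
    exists (X : C) (f : hom X Y) (a : hom X X'),
      is_pullback f a b f' /\ adm_epi f;
  ex_pushout : forall (X Y X' : C) (f : hom X Y) (a : hom X X'),
    adm_mono f ->
    exists (Y' : C) (b : hom Y Y') (f' : hom X' Y'),
      is_pushout f a b f' /\ adm_mono f';
  ex_epi_obscure : forall (X Y Z : C) (f : hom X Y) (g : hom Y Z),
    (exists (K : C) (k : hom K Y), is_kernel k g) ->
    adm_epi (g \oc f) -> adm_epi g;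
  ex_mono_obscure : forall (X Y Z : C) (f : hom X Y) (g : hom Y Z),
    (exists (K : C) (k : hom Y K), is_cokernel f k) ->
    adm_mono (g \oc f) -> adm_mono f
}.

Definition S_projective (P : C) : Prop :=
  forall (Y Z : C) (g : hom Y Z), adm_epi g ->
  forall t : hom P Z, exists s : hom P Y, g \oc s = t.

Definition S_injective (I : C) : Prop :=
  forall (X Y : C) (f : hom X Y), adm_mono f ->
  forall t : hom X I, exists s : hom Y I, s \oc f = t.

End SeqClassTheory.

Record ExactCat := MkExactCat {
  excat :> AddCat;
  ses : SeqClass excat;
  exactP : exact_axioms ses
}.

Arguments ses {e} [X Y Z] f g.

Definition inj_object (E : ExactCat) (I : E) : Prop := S_injective (@ses E) I.
Definition proj_object (E : ExactCat) (P : E) : Prop := S_projective (@ses E) P.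

Definition Frobenius (E : ExactCat) : Prop :=
  [/\ forall X : E, exists (P : E) (g : hom P X),
        proj_object P /\ adm_epi (@ses E) g,
      forall X : E, exists (I : E) (f : hom X I),
        inj_object I /\ adm_mono (@ses E) f
    & forall X : E, proj_object X <-> inj_object X].

Definition complete (E : ExactCat) (D : FullSubcat E) : Prop :=
  nonempty D /\
  forall (X Y Z : E) (f : hom X Y) (g : hom Y Z), ses f g -> two_of_three D X Y Z.

Definition thick (E : ExactCat) (D : FullSubcat E) : Prop :=
  complete D /\ summand_closed D.

Definition contains_inj (E : ExactCat) (D : FullSubcat E) : Prop :=
  forall I : E, inj_object I -> D I.

(** * Categories with a translation and a class of triangles *)

Record AddEndofunctor (C : PreAddCat) := MkAddEndofunctor {
  fobj :> C -> C;
  fmap : forall X Y : C, hom X Y -> hom (fobj X) (fobj Y);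
  fmap1 : forall X : C, fmap (idm X) = idm (fobj X);
  fmapM : forall (X Y Z : C) (g : hom Y Z) (f : hom X Y),
    fmap (g \oc f) = fmap g \oc fmap f;
  fmapD : forall (X Y : C) (f g : hom X Y), fmap (f + g) = fmap f + fmap g
}.

Arguments fmap {C} a [X Y] f.

(* The data of a triangulated category; its axioms play no role in the notion
   of a triangulated subcategory and are not recorded. *)
Record TriangleCat := MkTriangleCat {
  tricat :> AddCat;
  shift : AddEndofunctor tricat;
  distinguished : forall X Y Z : tricat,
    hom X Y -> hom Y Z -> hom Z (shift X) -> Prop
}.

Arguments distinguished {t} [X Y Z] u v w.

Definition triangle_iso (C : PreAddCat) (T : AddEndofunctor C)
    (X Y Z : C) (u : hom X Y) (v : hom Y Z) (w : hom Z (T X))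
    (X' Y' Z' : C) (u' : hom X' Y') (v' : hom Y' Z') (w' : hom Z' (T X')) : Prop :=
  exists (a : hom X X') (b : hom Y Y') (c : hom Z Z'),
    [/\ is_iso a, is_iso b & is_iso c] /\
    [/\ b \oc u = u' \oc a, c \oc v = v' \oc b & fmap T a \oc w = w' \oc c].

Definition triangulated_subcat (K : TriangleCat) (D : FullSubcat K) : Prop :=
  nonempty D /\
  forall (X Y Z : K) (u : hom X Y) (v : hom Y Z) (w : hom Z (shift K X)),
    distinguished u v w -> two_of_three D X Y Z.

Definition thick_triangulated_subcat (K : TriangleCat) (D : FullSubcat K) : Prop :=
  triangulated_subcat D /\ summand_closed D.

(** * The stable category *)

Section PreAddTheory.
Variable C : PreAddCat.

Lemma comp0m (X Y Z : C) (f : hom X Y) : (0 : hom Y Z) \oc f = 0.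
Proof. by apply: (addrI ((0 : hom Y Z) \oc f)); rewrite -compDl !addr0. Qed.

Lemma compm0 (X Y Z : C) (g : hom Y Z) : g \oc (0 : hom X Y) = 0.
Proof. by apply: (addrI (g \oc (0 : hom X Y))); rewrite -compDr !addr0. Qed.

Lemma compNm (X Y Z : C) (g : hom Y Z) (f : hom X Y) : (- g) \oc f = - (g \oc f).
Proof. by apply: (addrI (g \oc f)); rewrite -compDl !subrr comp0m. Qed.

Lemma compmN (X Y Z : C) (g : hom Y Z) (f : hom X Y) : g \oc (- f) = - (g \oc f).
Proof. by apply: (addrI (g \oc f)); rewrite -compDr !subrr compm0. Qed.

Lemma compBl (X Y Z : C) (g g' : hom Y Z) (f : hom X Y) :
  (g - g') \oc f = g \oc f - g' \oc f.
Proof. by rewrite compDl compNm. Qed.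

Lemma compBr (X Y Z : C) (g : hom Y Z) (f f' : hom X Y) :
  g \oc (f - f') = g \oc f - g \oc f'.
Proof. by rewrite compDr compmN. Qed.

End PreAddTheory.

Section Stable.
Variable E : ExactCat.
Implicit Types X Y Z I : E.

Definition through_inj X Y (f : hom X Y) : Prop :=
  exists (I : E) (a : hom X I) (b : hom I Y), inj_object I /\ b \oc a = f.

Lemma injective_biproduct I J B (i1 : hom I B) (i2 : hom J B)
    (p1 : hom B I) (p2 : hom B J) :
  is_biproduct i1 i2 p1 p2 -> inj_object I -> inj_object J -> inj_object B.
Proof.
move=> [_ _ _ _ e] hI hJ X Y f hf t.
have [s1 h1] := hI _ _ _ hf (p1 \oc t).
have [s2 h2] := hJ _ _ _ hf (p2 \oc t).
exists (i1 \oc s1 + i2 \oc s2).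
by rewrite compDl -!compA h1 h2 !compA -compDl e comp1m.
Qed.

Lemma through_inj0 X Y : through_inj (0 : hom X Y).
Proof.
have [Z [hZ _]] := has_zero E.
exists Z, 0, 0; split; last by rewrite compm0.
by move=> A B f _ t; exists 0; rewrite comp0m [t]hZ.
Qed.

Lemma through_injB X Y (f g : hom X Y) :
  through_inj f -> through_inj g -> through_inj (f - g).
Proof.
move=> [I [a [b [hI <-]]]] [J [c [d [hJ <-]]]].
have [B [i1 [i2 [p1 [p2 hB]]]]] := has_biproducts I J.
exists B, (i1 \oc a + i2 \oc c), (b \oc p1 - d \oc p2); split.
  exact: injective_biproduct hB hI hJ.
case: hB => e11 e22 e12 e21 _.
rewrite compBl !compDr -!compA !(compA p1) !(compA p2) e11 e22 e12 e21.
by rewrite !comp1m !comp0m !compm0 addr0 add0r.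
Qed.

Lemma through_injMl X Y Z (g : hom Y Z) (f : hom X Y) :
  through_inj f -> through_inj (g \oc f).
Proof. by move=> [I [a [b [hI <-]]]]; exists I, a, (g \oc b); rewrite compA. Qed.

Lemma through_injMr X Y Z (g : hom Y Z) (f : hom X Y) :
  through_inj g -> through_inj (g \oc f).
Proof. by move=> [I [a [b [hI <-]]]]; exists I, (a \oc f), b; rewrite compA. Qed.

Definition inj_subgroup X Y : {pred hom X Y} := fun f => `[< through_inj f >].

Lemma inj_subgroup_closed X Y : zmod_closed (@inj_subgroup X Y).
Proof.
split; first by apply/asboolP/through_inj0.
by move=> f g /asboolP hf /asboolP hg; apply/asboolP/through_injB.
Qed.

HB.instance Definition _ X Y :=
  GRing.isZmodClosed.Build (hom X Y) (@inj_subgroup X Y)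
    (@inj_subgroup_closed X Y).

Definition stable_hom X Y : zmodType := Quotient.quot (@inj_subgroup X Y).

Definition cls X Y (f : hom X Y) : stable_hom X Y :=
  \pi_(Quotient.quot (@inj_subgroup X Y)) f.

Definition rep X Y (s : stable_hom X Y) : hom X Y := repr s.

Lemma repK X Y (s : stable_hom X Y) : cls (rep s) = s.
Proof. exact: reprK. Qed.

Lemma clsP X Y (f g : hom X Y) : cls f = cls g <-> through_inj (f - g).
Proof.
rewrite /cls; split => [/eqP|h]; last apply/eqP;
  rewrite -Quotient.idealrBE; first by move=> /asboolP.
exact/asboolP.
Qed.

Lemma clsD X Y (f g : hom X Y) : cls (f + g) = cls f + cls g.
Proof. exact: pi_addr. Qed.

Lemma cls0 X Y : cls (0 : hom X Y) = 0.
Proof. by apply: (addrI (cls 0)); rewrite -clsD !addr0. Qed.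

Definition stable_comp X Y Z (t : stable_hom Y Z) (s : stable_hom X Y) :
  stable_hom X Z := cls (rep t \oc rep s).

Lemma stable_compE X Y Z (g : hom Y Z) (f : hom X Y) :
  stable_comp (cls g) (cls f) = cls (g \oc f).
Proof.
apply/clsP.
set g' := rep _; set f' := rep _.
have hg : through_inj (g' - g) by apply/clsP; rewrite repK.
have hf : through_inj (f - f') by apply/clsP; rewrite repK.
have -> : g' \oc f' - g \oc f = (g' - g) \oc f' - g \oc (f - f').
  by rewrite compBl compBr opprB addrA subrK.
by apply: through_injB; [apply: through_injMr | apply: through_injMl].
Qed.

Lemma stable_compA W X Y Z (h : stable_hom Y Z) (g : stable_hom X Y)
    (f : stable_hom W X) :
  stable_comp h (stable_comp g f) = stable_comp (stable_comp h g) f.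
Proof. by rewrite -(repK h) -(repK g) -(repK f) !stable_compE compA. Qed.

Lemma stable_comp1m X Y (f : stable_hom X Y) : stable_comp (cls (idm Y)) f = f.
Proof. by rewrite -(repK f) stable_compE comp1m. Qed.

Lemma stable_compm1 X Y (f : stable_hom X Y) : stable_comp f (cls (idm X)) = f.
Proof. by rewrite -(repK f) stable_compE compm1. Qed.

Lemma stable_compDl X Y Z (g g' : stable_hom Y Z) (f : stable_hom X Y) :
  stable_comp (g + g') f = stable_comp g f + stable_comp g' f.
Proof.
by rewrite -(repK g) -(repK g') -(repK f) -clsD !stable_compE compDl clsD.
Qed.

Lemma stable_compDr X Y Z (g : stable_hom Y Z) (f f' : stable_hom X Y) :
  stable_comp g (f + f') = stable_comp g f + stable_comp g f'.
Proof.
by rewrite -(repK g) -(repK f') -(repK f) -clsD !stable_compE compDr clsD.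
Qed.

Definition stable_preadd : PreAddCat :=
  @MkPreAddCat (obj E) stable_hom (fun X => cls (idm X)) stable_comp
    stable_compA stable_comp1m stable_compm1 stable_compDl stable_compDr.

Lemma stable_has_zero : exists Z : stable_preadd, is_zero Z.
Proof.
have [Z [h1 h2]] := has_zero E; exists Z; split=> X f.
  by rewrite -(repK (f : stable_hom _ _)) [rep _]h1 cls0.
by rewrite -(repK (f : stable_hom _ _)) [rep _]h2 cls0.
Qed.

Lemma stable_has_biproducts (X Y : stable_preadd) :
  exists (B : stable_preadd) (i1 : hom X B) (i2 : hom Y B)
         (p1 : hom B X) (p2 : hom B Y), is_biproduct i1 i2 p1 p2.
Proof.
have [B [i1 [i2 [p1 [p2 [e11 e22 e12 e21 e]]]]]] :=
  has_biproducts (X : E) (Y : E).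
exists B, (cls i1), (cls i2), (cls p1), (cls p2).
rewrite /is_biproduct /= !stable_compE e11 e22 e12 e21.
by split; rewrite ?cls0 // -clsD e.
Qed.

Definition stable : AddCat := MkAddCat stable_has_zero stable_has_biproducts.

End Stable.

Arguments stable E : clear implicits.

(** * The triangles of the stable category *)

(* The choice, for each X, of a sequence X --mu--> I --pi--> TX in S with I
   injective. *)
Record InjChoice (E : ExactCat) := MkInjChoice {
  hull : E -> E;
  cosyz : E -> E;
  inj_mu : forall X : E, hom X (hull X);
  inj_pi : forall X : E, hom (hull X) (cosyz X);
  hull_ses : forall X : E, ses (inj_mu X) (inj_pi X);
  hull_inj : forall X : E, inj_object (hull X)
}.

Arguments inj_mu {E} i X.
Arguments inj_pi {E} i X.

Section Triangles.
Variables (E : ExactCat) (c : InjChoice E).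
Implicit Types X Y Z : E.

Local Notation T := (cosyz c).

Definition induced X Y (f : hom X Y) (t : hom (T X) (T Y)) : Prop :=
  exists e : hom (hull c X) (hull c Y),
    e \oc inj_mu c X = inj_mu c Y \oc f /\ t \oc inj_pi c X = inj_pi c Y \oc e.

Lemma induced_exists X Y (f : hom X Y) : exists t, induced f t.
Proof.
have [e he] : exists e, e \oc inj_mu c X = inj_mu c Y \oc f.
  by apply: (@hull_inj _ c Y); exists (T X), (inj_pi c X); apply: hull_ses.
have [_ coX] := ex_cokernel (exactP E) (hull_ses c X).
have [zY _] := ex_cokernel (exactP E) (hull_ses c Y).
have [|t [ht _]] := coX _ (inj_pi c Y \oc e).
  by rewrite -compA he compA zY comp0m.
by exists t, e.
Qed.

Lemma induced_through_inj X Y (f : hom X Y) t :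
  induced f t -> through_inj f -> through_inj t.
Proof.
move=> [e [he ht]] [I [a [b [hI hf]]]].
have [a' ha'] : exists a', a' \oc inj_mu c X = a.
  by apply: hI; exists (T X), (inj_pi c X); apply: hull_ses.
have [zX coX] := ex_cokernel (exactP E) (hull_ses c X).
have [zY _] := ex_cokernel (exactP E) (hull_ses c Y).
have [|s [hs _]] := coX _ (e - inj_mu c Y \oc b \oc a').
  by rewrite compBl -!compA ha' hf he subrr.
have [r [_ ru]] := coX _ (t \oc inj_pi c X) (etrans (esym (compA _ _ _))
  (etrans (congr1 _ zX) (compm0 _ _))).
exists (hull c Y), s, (inj_pi c Y); split; first exact: hull_inj.
rewrite -(ru t erefl); apply/esym/ru.
by rewrite -compA hs compBr -!compA (compA (inj_pi c Y)) zY comp0m subr0 ht.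
Qed.

Lemma inducedB X Y (f g : hom X Y) s t :
  induced f s -> induced g t -> induced (f - g) (s - t).
Proof.
move=> [d [hd hs]] [e [he ht]]; exists (d - e).
by rewrite !compBl !compBr hd he hs ht.
Qed.

Lemma inducedD X Y (f g : hom X Y) s t :
  induced f s -> induced g t -> induced (f + g) (s + t).
Proof.
move=> [d [hd hs]] [e [he ht]]; exists (d + e).
by rewrite !compDl !compDr hd he hs ht.
Qed.

Lemma induced1 X : induced (idm X) (idm (T X)).
Proof. by exists (idm _); rewrite !comp1m !compm1. Qed.

Lemma inducedM X Y Z (g : hom Y Z) (f : hom X Y) s t :
  induced f s -> induced g t -> induced (g \oc f) (t \oc s).
Proof.
move=> [d [hd hs]] [e [he ht]]; exists (e \oc d); split.
  by rewrite -compA hd compA he compA.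
by rewrite -compA hs compA ht compA.
Qed.

Definition shift_map (X Y : stable E) (f : hom X Y) :
    hom (T X : stable E) (T Y) :=
  cls (projT1 (cid (induced_exists (rep (f : stable_hom X Y))))).

Lemma shift_mapE X Y (f : hom X Y) t :
  induced f t -> shift_map (cls f) = cls t.
Proof.
move=> ht; rewrite /shift_map; case: cid => s /= hs.
apply/clsP/(induced_through_inj (inducedB hs ht)).
by apply/clsP; rewrite repK.
Qed.

Lemma shift_map1 (X : stable E) : shift_map (idm X) = idm (T X : stable E).
Proof. exact/shift_mapE/induced1. Qed.

Lemma shift_mapM (X Y Z : stable E) (g : hom Y Z) (f : hom X Y) :
  shift_map (g \oc f) = shift_map g \oc shift_map f.
Proof.
rewrite -(repK (g : stable_hom _ _)) -(repK (f : stable_hom _ _)).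
have [s hs] := induced_exists (rep (f : stable_hom _ _)).
have [t ht] := induced_exists (rep (g : stable_hom _ _)).
rewrite /= stable_compE (shift_mapE hs) (shift_mapE ht) stable_compE.
exact: shift_mapE (inducedM hs ht).
Qed.

Lemma shift_mapD (X Y : stable E) (f g : hom X Y) :
  shift_map (f + g) = shift_map f + shift_map g.
Proof.
rewrite -(repK (g : stable_hom _ _)) -(repK (f : stable_hom _ _)).
have [s hs] := induced_exists (rep (f : stable_hom _ _)).
have [t ht] := induced_exists (rep (g : stable_hom _ _)).
rewrite -clsD (shift_mapE hs) (shift_mapE ht) -clsD.
exact: shift_mapE (inducedD hs ht).
Qed.

Definition stable_shift : AddEndofunctor (stable E) :=
  @MkAddEndofunctor (stable E) T shift_map shift_map1 shift_mapM shift_mapD.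

(* The sequence X --f--> Y --g--> C --h--> TX in E whose image in the stable
   category is a standard triangle. Every pushout of mu and f is allowed. *)
Definition standard_seq X Y C (f : hom X Y) (g : hom Y C) (h : hom C (T X)) :
    Prop :=
  exists fbar : hom (hull c X) C,
    [/\ is_pushout f (inj_mu c X) g fbar, h \oc g = 0 & h \oc fbar = inj_pi c X].

Definition stable_distinguished (X Y Z : stable E) (u : hom X Y) (v : hom Y Z)
    (w : hom Z (stable_shift X)) : Prop :=
  exists (X' Y' C : E) (f : hom X' Y') (g : hom Y' C) (h : hom C (T X')),
    standard_seq f g h /\
    @triangle_iso (stable E) stable_shift X Y Z u v w
      X' Y' C (cls f) (cls g) (cls h).

Definition stable_tri : TriangleCat :=
  @MkTriangleCat (stable E) stable_shift stable_distinguished.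

End Triangles.

(** * The correspondence *)

Definition stable_image (E : ExactCat) (D : FullSubcat E) :
  FullSubcat (stable E) := fun X => D X.

Definition stable_preimage (E : ExactCat) (D : FullSubcat (stable E)) :
  FullSubcat E := fun X => D X.

Definition inverse_bijections (A B : Type) (P : A -> Prop) (Q : B -> Prop)
    (F : A -> B) (G : B -> A) : Prop :=
  [/\ forall a, P a -> Q (F a), forall b, Q b -> P (G b),
      forall a, P a -> G (F a) = a & forall b, Q b -> F (G b) = b].

(* Main.v *)
From mathcomp Require Import all_boot all_algebra.
Require Import Defs.

(** A pushout of [X --f--> Y] and of an inflation [X --m--> I] yields the
    conflation [X -> Y (+) I -> C]. With [I] injective, complete subcategories
    containing the injectives do not see the summand [I], so that standard
    triangles satisfy two-out-of-three; applied to a stable isomorphism [f], whose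
    cone is injective, the same conflation shows that such subcategories are closed
    under stable isomorphism. Conversely, for a conflation [X -> Y -> Z] the map
    [C -> Z] from the cone of [X -> Y] is a stable isomorphism, so conflations
    become distinguished triangles, and the triangle on [idm X] puts every injective
    object in a triangulated subcategory. *)

Set Implicit Arguments.
Unset Strict Implicit.
Unset Printing Implicit Defensive.

Import GRing.Theory.
Local Open Scope ring_scope.

(** * Pushouts and cokernels in preadditive categories *)

Lemma is_iso_idm (C : PreAddCat) (X : C) : is_iso (idm X).
Proof. by exists (idm X); rewrite comp1m. Qed.

Lemma is_pushout_sym (C : PreAddCat) (X Y X' Y' : C) (f : hom X Y)
    (a : hom X X') (b : hom Y Y') (f' : hom X' Y') :
  is_pushout f a b f' -> is_pushout a f f' b.
Proof.
move=> [e u]; split=> [//|W s t st].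
have [r [[r1 r2] ru]] := u W t s (esym st).
by exists r; split=> // r' [r1' r2']; apply: ru.
Qed.

Lemma is_pushout_epi (C : PreAddCat) (X Y X' Y' W : C) (f : hom X Y)
    (a : hom X X') (b : hom Y Y') (f' : hom X' Y') (r r' : hom Y' W) :
  is_pushout f a b f' -> r \oc b = r' \oc b -> r \oc f' = r' \oc f' -> r = r'.
Proof.
move=> [e u] eb ef; have [|s [_ su]] := u W (r \oc b) (r \oc f').
  by rewrite -!compA e.
by rewrite -(su r) // (su r').
Qed.

Lemma is_cokernel_epi (C : PreAddCat) (X Y Z W : C) (f : hom X Y) (g : hom Y Z)
    (r r' : hom Z W) :
  is_cokernel f g -> r \oc g = r' \oc g -> r = r'.
Proof.
move=> [e u] eg; have [|s [_ su]] := u W (r \oc g).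
  by rewrite -compA e compm0.
by rewrite -(su r) // (su r').
Qed.

(** A map [t] out of [B] kills [i1 \oc f + i2 \oc m] exactly when [t \oc i1] and [- (t \oc i2)]
    agree on [X], that is, form a cocone for the pushout; hence the minus sign. *)
Lemma pushout_cokernel (C : PreAddCat) (X Y I Z B : C) (f : hom X Y)
    (m : hom X I) (g : hom Y Z) (k : hom I Z)
    (i1 : hom Y B) (i2 : hom I B) (p1 : hom B Y) (p2 : hom B I) :
  is_pushout f m g k -> is_biproduct i1 i2 p1 p2 ->
  is_cokernel (i1 \oc f + i2 \oc m) (g \oc p1 - k \oc p2).
Proof.
move=> po [e11 e22 e12 e21 e1]; have [e u] := po.
have q1 : (g \oc p1 - k \oc p2) \oc i1 = g.
  by rewrite compBl -!compA e11 e21 compm1 compm0 subr0.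
have q2 : (g \oc p1 - k \oc p2) \oc i2 = - k.
  by rewrite compBl -!compA e22 e12 compm1 compm0 sub0r.
split=> [|W t]; first by rewrite compDr !compA q1 q2 compNm e subrr.
rewrite compDr !compA => /eqP; rewrite addr_eq0 -compNm => /eqP h.
have [r [[r1 r2] _]] := u _ _ _ h.
exists r; split=> [|r' hr'].
  by rewrite compBr !compA r1 r2 compNm opprK -!compA -compDr e1 compm1.
apply: (is_pushout_epi po); first by rewrite r1 -hr' -compA q1.
by rewrite r2 -hr' -compA q2 compmN opprK.
Qed.

(** * Conflations and injective objects *)

Section Exact.
Variable E : ExactCat.
Implicit Types (X Y Z I J : E) (D : FullSubcat E).

(** Cokernels are unique up to isomorphism, and the class of conflations is closed under
    isomorphism. *)
Lemma ses_cokernel X Y Z (f : hom X Y) (g : hom Y Z) :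
  adm_mono (@ses E) f -> is_cokernel f g -> ses f g.
Proof.
move=> [Z' [g' fg']] co; have co' := ex_cokernel (exactP E) fg'.
have [a [ha _]] := co'.2 _ g co.1; have [b [hb _]] := co.2 _ g' co'.1.
apply: (ex_iso (c := a) (exactP E) (is_iso_idm X) (is_iso_idm Y) _ _ _ fg').
- exists b; split.
  + by apply: (is_cokernel_epi co'); rewrite -compA ha hb comp1m.
  + by apply: (is_cokernel_epi co); rewrite -compA hb ha comp1m.
- by rewrite comp1m compm1.
- by rewrite compm1.
Qed.

(** Composing the first map with [p2] gives the inflation [m], and the first map has a cokernel, so
    the obscure axiom makes it an inflation. *)
Lemma pushout_ses X Y I Z B (f : hom X Y) (m : hom X I) (g : hom Y Z)
    (k : hom I Z) (i1 : hom Y B) (i2 : hom I B) (p1 : hom B Y) (p2 : hom B I) :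
  adm_mono (@ses E) m -> is_pushout f m g k -> is_biproduct i1 i2 p1 p2 ->
  ses (i1 \oc f + i2 \oc m) (g \oc p1 - k \oc p2).
Proof.
move=> hm po bi; have co := pushout_cokernel po bi.
apply: ses_cokernel (co).
apply: (ex_mono_obscure (exactP E) (g := p2)).
  by exists Z, (g \oc p1 - k \oc p2).
by case: bi => _ e22 _ e21 _; rewrite compDr !compA e22 e21 comp1m comp0m add0r.
Qed.

Lemma inj_object_through_id I : through_inj (idm I) -> inj_object I.
Proof.
move=> [J [a [b [hJ ba]]]] X Y f hf t.
have [s hs] := hJ _ _ _ hf (a \oc t).
by exists (b \oc s); rewrite -compA hs compA ba comp1m.
Qed.

Lemma cls_inj_dom I X (f : hom I X) : inj_object I -> cls f = 0.
Proof.
move=> hI; rewrite -cls0; apply/clsP.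
by exists I, (idm I), f; rewrite compm1 subr0.
Qed.

Lemma cls_inj_cod X I (f : hom X I) : inj_object I -> cls f = 0.
Proof.
move=> hI; rewrite -cls0; apply/clsP.
by exists I, f, (idm I); rewrite comp1m subr0.
Qed.

Lemma is_zero_stable I : inj_object I -> is_zero (I : stable E).
Proof.
move=> hI; split=> X f; rewrite -(repK (f : stable_hom _ _)).
  exact: cls_inj_cod.
exact: cls_inj_dom.
Qed.

Lemma is_summand_stable A X : is_summand A X -> is_summand (A : stable E) X.
Proof.
move=> [i [p pi]]; exists (cls i), (cls p).
by rewrite /= stable_compE pi.
Qed.

Lemma complete_biproduct D Y I B (i1 : hom Y B) (i2 : hom I B)
    (p1 : hom B Y) (p2 : hom B I) :
  complete D -> contains_inj D -> is_biproduct i1 i2 p1 p2 -> inj_object I ->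
  D Y <-> D B.
Proof.
move=> [_ cD] iD bi hI; have DI := iD _ hI.
have [_ h1 h2] := cD _ _ _ _ _ (ex_split (exactP E) bi).
by split=> h; [apply: h1 | apply: h2].
Qed.

End Exact.

(** * From complete subcategories to triangulated ones *)

Section Hull.
Variables (E : ExactCat) (c : InjChoice E).
Implicit Types (X Y Z I J : E) (D : FullSubcat E).

Lemma inj_mu_mono X : adm_mono (@ses E) (inj_mu c X).
Proof. by exists (cosyz c X), (inj_pi c X); apply: hull_ses. Qed.

Lemma through_inj_hull X Y (f : hom X Y) :
  through_inj f -> exists b : hom (hull c X) Y, b \oc inj_mu c X = f.
Proof.
move=> [I [a [b [hI <-]]]].
have [s <-] := hI _ _ _ (inj_mu_mono X) a.
by exists (b \oc s); rewrite -compA.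
Qed.

Lemma standard_seq_exists X Y (f : hom X Y) :
  exists (C : E) (g : hom Y C) (h : hom C (cosyz c X)), standard_seq f g h.
Proof.
have [C [k [g [/is_pushout_sym po _]]]] :=
  ex_pushout (exactP E) f (inj_mu_mono X).
have [zX _] := ex_cokernel (exactP E) (hull_ses c X).
have [|h [[hg hk] _]] := po.2 _ (0 : hom Y (cosyz c X)) (inj_pi c X).
  by rewrite zX comp0m.
by exists C, g, h, k.
Qed.

Lemma standard_two_of_three D X Y Z (f : hom X Y) (g : hom Y Z)
    (h : hom Z (cosyz c X)) :
  complete D -> contains_inj D -> standard_seq f g h -> two_of_three D X Y Z.
Proof.
move=> cD iD [k [po _ _]].
have [B [i1 [i2 [p1 [p2 bi]]]]] := has_biproducts Y (hull c X).
have YB := complete_biproduct cD iD bi (@hull_inj _ c X).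
have [h1 h2 h3] := cD.2 _ _ _ _ _ (pushout_ses (inj_mu_mono X) po bi).
split.
- by move=> dX /YB; apply: h1.
- by move=> dX dZ; apply/YB/h2.
- by move=> /YB; apply: h3.
Qed.

(* The correction [- b], with [g \oc f - idm X = b \oc inj_mu c X], turns a
   stable retraction [g] of [f] into a retraction of [(f, mu)]. *)
Lemma stable_retract X Y B (i1 : hom Y B) (i2 : hom (hull c X) B)
    (p1 : hom B Y) (p2 : hom B (hull c X)) (f : hom X Y) (g : hom Y X) :
  is_biproduct i1 i2 p1 p2 -> cls (g \oc f) = cls (idm X) ->
  exists b : hom (hull c X) X,
    (g \oc p1 - b \oc p2) \oc (i1 \oc f + i2 \oc inj_mu c X) = idm X.
Proof.
move=> [e11 e22 e12 e21 _] /clsP /through_inj_hull [b hb]; exists b.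
rewrite compDr !compBl -!compA !(compA p1) !(compA p2) e11 e12 e21 e22.
by rewrite !comp1m !comp0m !compm0 subr0 sub0r hb opprB addrC subrK.
Qed.

(** The retraction [p] of the inflation [i : X -> B] splits the conflation [X -> B -> K]; as [i] is
    stably invertible, the complement [K] is stably zero, hence injective. *)
Lemma stable_iso_closed D X Y :
  complete D -> contains_inj D ->
  (exists u : hom (X : stable E) (Y : stable E), is_iso u) -> D X <-> D Y.
Proof.
move=> cD iD [u [v]].
rewrite -(repK (u : stable_hom X Y)) -(repK (v : stable_hom Y X)) /= !stable_compE.
set f := rep u; set g := rep v => -[gf fg].
have [B [i1 [i2 [p1 [p2 bi]]]]] := has_biproducts Y (hull c X).
have YB := complete_biproduct cD iD bi (@hull_inj _ c X).
have [b pi] := stable_retract bi gf.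
set p := g \oc p1 - _ in pi; set i := i1 \oc f + _ in pi.
have [K [k [w [r [po _ _]]]]] := standard_seq_exists f.
have iq := pushout_ses (inj_mu_mono X) po bi.
have co := ex_cokernel (exactP E) iq.
set q := k \oc p1 - _ in iq co.
(* The idempotent [idm B - i \oc p] kills [i], so it factors through [q]; the factor [j] is a
   section of [q]. *)
have [|j [jq _]] := co.2 _ (idm B - i \oc p).
  by rewrite compBl -compA pi comp1m compm1 subrr.
have qj : q \oc j = idm K.
  apply: (is_cokernel_epi co).
  by rewrite -compA jq compBr compA co.1 comp0m compm1 subr0 comp1m.
have hK : inj_object K.
  apply/inj_object_through_id.
  (* Indeed [idm K] equals [q \oc (j \oc q) \oc j], with the idempotent in the middle. *)
  suff h : through_inj (idm B - i \oc p).
    rewrite -qj -(compm1 j) -qj (compA j) jq.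
    by apply: through_injMl; apply: through_injMr.
  apply/clsP; case: bi => _ _ _ _ e.
  have hI := @hull_inj _ c X.
  (* Stably the summand [hull c X] vanishes, so [i \oc p] becomes [i1 \oc f \oc g \oc p1], then
     [i1 \oc p1], which is the identity. *)
  have z2 Z (t : hom Z (hull c X)) : cls (i2 \oc t) = 0.
    by rewrite -stable_compE (cls_inj_cod t hI); apply: (@compm0 (stable E)).
  have zb : cls (b \oc p2) = 0.
    by rewrite -stable_compE (cls_inj_cod p2 hI); apply: (@compm0 (stable E)).
  have ci : cls i = cls (i1 \oc f) by rewrite clsD z2 addr0.
  have cp : cls p = cls (g \oc p1).
    by rewrite -[g \oc p1](subrK (b \oc p2)) clsD zb addr0.
  rewrite -stable_compE ci cp stable_compE -compA (compA f) -e clsD z2 addr0.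
  rewrite -(stable_compE i1 (_ \oc p1)) -(stable_compE (f \oc g)) fg.
  by rewrite !stable_compE comp1m.
have [_ h2 h3] := cD.2 _ _ _ _ _ iq.
by split=> [dX|/YB dB]; [apply/YB/h2 => //|apply: h3 => //]; apply: iD.
Qed.

Lemma stable_image_triangulated D :
  complete D -> contains_inj D ->
  triangulated_subcat (stable_image D : FullSubcat (stable_tri c)).
Proof.
move=> cD iD; split; first by case: cD.
move=> X Y Z u v w [X' [Y' [C [f [g [h [sq [a [b [d [[ha hb hd] _]]]]]]]]]]].
have eX : D X <-> D X' by apply: stable_iso_closed => //; exists a.
have eY : D Y <-> D Y' by apply: stable_iso_closed => //; exists b.
have eZ : D Z <-> D C by apply: stable_iso_closed => //; exists d.
have [h1 h2 h3] := standard_two_of_three cD iD sq.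
split.
- by move=> /eX x /eY y; apply/eZ/h1.
- by move=> /eX x /eZ z; apply/eY/h2.
- by move=> /eY y /eZ z; apply/eX/h3.
Qed.

(** A stable summand [A] of [X] is an honest summand of the biproduct of [X] and [hull c A]. *)
Lemma stable_image_summand_closed D :
  thick D -> contains_inj D -> summand_closed (stable_image D).
Proof.
move=> [cD sD] iD A X [u [v]].
rewrite -(repK (u : stable_hom A X)) -(repK (v : stable_hom X A)) /= stable_compE.
move=> vu dX.
have [B [i1 [i2 [p1 [p2 bi]]]]] := has_biproducts (X : E) (hull c A).
have [b pi] := stable_retract bi vu.
apply: (sD A B); first by eexists; eexists; exact: pi.
exact/(complete_biproduct cD iD bi (@hull_inj _ c A)).
Qed.

(** * From triangulated subcategories to complete ones *)

Lemma triangulated_contains_inj (D : FullSubcat (stable_tri c)) :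
  triangulated_subcat D -> contains_inj (stable_preimage D).
Proof.
move=> [[X dX] tD] J hJ.
have zJ := is_zero_stable hJ; have zH := is_zero_stable (@hull_inj _ c X).
(* The cone of [idm X] is [hull c X], and both it and [J] are stably zero, so [J] may replace it. *)
suff dist : @distinguished (stable_tri c) X X J (idm _) 0 0.
  by have [h _ _] := tD _ _ _ _ _ _ dist; apply: h.
exists X, X, (hull c X), (idm (X : E)), (inj_mu c X), (inj_pi c X); split.
  exists (idm _); split; last 1 first.
  - by rewrite compm1.
  - split=> [|W s t]; first by rewrite compm1 comp1m.
    rewrite compm1 => ->; exists t; split; first by rewrite compm1.
    by move=> t' [_]; rewrite compm1.
  - by have [] := ex_cokernel (exactP E) (hull_ses c X).
exists (idm _), (idm _), 0; split; split; try exact: is_iso_idm; try by [].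
- by exists 0; split; [rewrite [RHS](zJ.1)|rewrite [RHS](zH.1)]; rewrite comp0m.
- by rewrite [LHS](zH.1) [RHS](zH.1).
- by rewrite [LHS](zJ.2) [RHS](zJ.2).
Qed.

(** The comparison [r : C -> Z] from the cone has a section [s] in [E], and [idm C - s \oc r]
    factors through the hull. Transporting [h] along [s] gives the third map. *)
Lemma ses_distinguished X Y Z (f : hom X Y) (q : hom Y Z) :
  ses f q ->
  exists w, @distinguished (stable_tri c) X Y Z (cls f) (cls q) w.
Proof.
move=> fq; have co := ex_cokernel (exactP E) fq.
have hI := @hull_inj _ c X.
have [C [g [h sq]]] := standard_seq_exists f; have [k [po _ _]] := sq.
have [|e he] := hI _ _ f _ (inj_mu c X); first by exists Z, q.
have [|r [[rg rk] _]] := po.2 _ q (0 : hom _ Z); first by rewrite co.1 comp0m.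
have [|s [sq' _]] := co.2 _ (g - k \oc e).
  by rewrite compBl -compA he po.1 subrr.
(* The extension [e] of [inj_mu c X] along [f] yields a retraction [l] of [k], with [k \oc l]
   complementary to [s \oc r]. *)
have [|l [[lg lk] _]] := po.2 _ e (idm _); first by rewrite he comp1m.
have rs : r \oc s = idm Z.
  apply: (is_cokernel_epi co).
  by rewrite -compA sq' compBr compA rg rk comp0m subr0 comp1m.
have sr : idm C - s \oc r = k \oc l.
  apply: (is_pushout_epi po); rewrite compBl comp1m -!compA.
  - by rewrite rg sq' lg opprB addrC subrK.
  - by rewrite rk compm0 subr0 lk compm1.
exists (cls (h \oc s)), X, Y, C, f, g, h; split=> //.
exists (idm _), (idm _), (cls s); split; split; try exact: is_iso_idm.
- exists (cls r); rewrite /= !stable_compE rs; split=> //.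
  by apply/esym/clsP; exists (hull c X), l, k.
- by rewrite comp1m compm1.
- rewrite compm1 /= stable_compE sq'; apply/esym/clsP.
  by exists (hull c X), e, k; rewrite opprB addrC subrK.
- by rewrite fmap1 comp1m /= stable_compE.
Qed.

Lemma stable_preimage_complete (D : FullSubcat (stable_tri c)) :
  triangulated_subcat D -> complete (stable_preimage D).
Proof.
move=> [nD tD]; split=> // X Y Z f g /ses_distinguished[w].
exact: tD.
Qed.

End Hull.

Theorem theorem3p15 (E : ExactCat) (hE : Frobenius E) (c : InjChoice E) :
  inverse_bijections
    (fun D : FullSubcat E => thick D /\ contains_inj D)
    (fun D : FullSubcat (stable_tri c) => thick_triangulated_subcat D)
    (@stable_image E) (@stable_preimage E)
  /\
  inverse_bijections
    (fun D : FullSubcat E => complete D /\ contains_inj D)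
    (fun D : FullSubcat (stable_tri c) => triangulated_subcat D)
    (@stable_image E) (@stable_preimage E).
Proof.
(* Both categories have the same objects, so the round trips are identities by conversion; only the
   preservation claims remain. *)
split; split=> // D.
- move=> [tD iD]; split; last exact: (stable_image_summand_closed c).
  exact: stable_image_triangulated tD.1 iD.
- move=> [tD sD]; split; last exact: triangulated_contains_inj tD.
  split; first exact: stable_preimage_complete tD.
  by move=> A X /is_summand_stable; apply: sD.
- by move=> [cD iD]; apply: stable_image_triangulated.
- move=> tD; split; first exact: stable_preimage_complete tD.
  exact: triangulated_contains_inj tD.
Qed.
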